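(* Let $n\in\mathbb{N}$ ($n\ge1$), $a,b\in\mathbb{R}$, $c\in\mathbb{R}\setminus\{0\}$, $1<p<\infty$ and $L\in\mathbb{R}$. Let $$g=c(y_1-a)^{n+1}+i(n+1)(y_2-b),\qquad h=c(y_1-a)^{n+1}-i(n+1)(y_2-b),$$ and $$f=f_{p,L}=\begin{cases} g^{\alpha}h^{\beta}, & p\neq n+2,\\ \log\big(g^{1+L}h^{1-L}\big), & p=n+2,\end{cases}\qquad \alpha=\frac{n+2-p}{(1-p)(2n+2)}(1+L),\quad \beta=\frac{n+2-p}{(1-p)(2n+2)}(1-L).$$ Put $\xi_1=Y_1f+iLY_2f$, $\xi_2=Y_2f-iLY_1f$, $\xi=(\xi_1,\xi_2)$. Then on $\mathbb{R}^2\setminus\{(a,b)\}$, $$\overline{\Delta_p}f:=Y_1\big(\|\xi\|^{p-2}\xi_1\big)+Y_2\big(\|\xi\|^{p-2}\xi_2\big)=0.$$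
   Context: The Grushin-type plane $\mathbb{G}_n$ is $\mathbb{R}^2$ with coordinates $(y_1,y_2)$ and the vector fields $Y_1=\frac{\partial}{\partial y_1}$, $Y_2=c(y_1-a)^n\frac{\partial}{\partial y_2}$. For $\xi=(\xi_1,\xi_2)$ with complex entries, $\|\xi\|^2=\xi_1\overline{\xi_1}+\xi_2\overline{\xi_2}$; the vector $\|\xi\|^{p-2}\xi$ is understood to be $0$ where $\xi=0$. Branch convention: note $h=\overline g$ and $g\ne0$ off $(a,b)$. Near each point of $\mathbb{R}^2\setminus\{(a,b)\}$ fix any smooth branch of $\log g$, put $\log h=\overline{\log g}$, and set $g^\alpha=e^{\alpha\log g}$, $h^\beta=e^{\beta\log h}$, $\log(g^{1+L}h^{1-L})=(1+L)\log g+(1-L)\log h$. The equation is local and is asserted for every such choice of branch. *)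

(* Defs.v *)
From Stdlib Require Import Reals.
From Coquelicot Require Export Coquelicot.

Open Scope R_scope.

Definition Cexp (z : C) : C :=
  (exp (Re z) * cos (Im z), exp (Re z) * sin (Im z)).

(* Partial derivatives of complex-valued functions of two real variables.
   [Derive] is total, so [D1] and [D2] are meaningful only together with
   [ex_D1] and [ex_D2]. *)
Definition D1 (F : R -> R -> C) (u v : R) : C :=
  (Derive (fun t => Re (F t v)) u, Derive (fun t => Im (F t v)) u).
Definition D2 (F : R -> R -> C) (u v : R) : C :=
  (Derive (fun t => Re (F u t)) v, Derive (fun t => Im (F u t)) v).
Definition ex_D1 (F : R -> R -> C) (u v : R) : Prop :=
  ex_derive (fun t => Re (F t v)) u /\ ex_derive (fun t => Im (F t v)) u.
Definition ex_D2 (F : R -> R -> C) (u v : R) : Prop :=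
  ex_derive (fun t => Re (F u t)) v /\ ex_derive (fun t => Im (F u t)) v.

Definition Y1 (F : R -> R -> C) (y1 y2 : R) : C := D1 F y1 y2.
Definition Y2 (n : nat) (a c : R) (F : R -> R -> C) (y1 y2 : R) : C :=
  (RtoC (c * (y1 - a) ^ n) * D2 F y1 y2)%C.

Definition g_fun (n : nat) (a b c : R) (y1 y2 : R) : C :=
  (RtoC (c * (y1 - a) ^ (n + 1)) + Ci * RtoC (INR (n + 1) * (y2 - b)))%C.
Definition h_fun (n : nat) (a b c : R) (y1 y2 : R) : C :=
  (RtoC (c * (y1 - a) ^ (n + 1)) - Ci * RtoC (INR (n + 1) * (y2 - b)))%C.

Lemma h_fun_conj (n : nat) (a b c y1 y2 : R) :
  h_fun n a b c y1 y2 = Cconj (g_fun n a b c y1 y2).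
Proof.
  unfold h_fun, g_fun, Cconj, Cminus, Cplus, Copp, Cmult, Ci, RtoC; simpl.
  f_equal; ring.
Qed.

Lemma Cexp_conj (z : C) : Cexp (Cconj z) = Cconj (Cexp z).
Proof.
  unfold Cexp, Cconj, Re, Im; simpl; rewrite cos_neg, sin_neg.
  f_equal; ring.
Qed.

(* [ex_diff_n] speaks of derivatives at a single point only; requiring it at
   every point of a neighbourhood, for every order, gives C^infinity there. *)
Definition smooth_log_branch_near
    (G lG : R -> R -> C) (x y : R) : Prop :=
  locally_2d (fun u v =>
    Cexp (lG u v) = G u v /\
    (forall k : nat, ex_diff_n (fun s t => Re (lG s t)) k u v /\
                     ex_diff_n (fun s t => Im (lG s t)) k u v)) x y.

Definition alpha (n : nat) (p L : R) : R :=
  (INR n + 2 - p) / ((1 - p) * (2 * INR n + 2)) * (1 + L).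
Definition beta (n : nat) (p L : R) : R :=
  (INR n + 2 - p) / ((1 - p) * (2 * INR n + 2)) * (1 - L).

(* [lg] is the chosen branch of log g; that of log h is [Cconj lg], a logarithm of
   [h_fun] by [h_fun_conj] and [Cexp_conj]. *)
Definition f_fun (n : nat) (p L : R) (lg : R -> R -> C) (y1 y2 : R) : C :=
  let log_g := lg y1 y2 in
  let log_h := Cconj (lg y1 y2) in
  if Req_EM_T p (INR n + 2)
  then (RtoC (1 + L) * log_g + RtoC (1 - L) * log_h)%C
  else (Cexp (RtoC (alpha n p L) * log_g) *
        Cexp (RtoC (beta n p L) * log_h))%C.

Definition xi1 (n : nat) (a c L : R) (f : R -> R -> C) (y1 y2 : R) : C :=
  (Y1 f y1 y2 + Ci * RtoC L * Y2 n a c f y1 y2)%C.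
Definition xi2 (n : nat) (a c L : R) (f : R -> R -> C) (y1 y2 : R) : C :=
  (Y2 n a c f y1 y2 - Ci * RtoC L * Y1 f y1 y2)%C.

Definition norm2 (z1 z2 : C) : R :=
  sqrt (Re (z1 * Cconj z1 + z2 * Cconj z2)%C).

(* The factor ||(z1, z2)||^(p-2), with value 0 at the zero vector because
   [Rpower 0 _] is a junk value. *)
Definition weight (p : R) (z1 z2 : C) : R :=
  if Req_EM_T (norm2 z1 z2) 0 then 0 else Rpower (norm2 z1 z2) (p - 2).

Definition flux1 (n : nat) (a c p L : R) (f : R -> R -> C) (y1 y2 : R) : C :=
  (RtoC (weight p (xi1 n a c L f y1 y2) (xi2 n a c L f y1 y2)) *
   xi1 n a c L f y1 y2)%C.
Definition flux2 (n : nat) (a c p L : R) (f : R -> R -> C) (y1 y2 : R) : C :=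
  (RtoC (weight p (xi1 n a c L f y1 y2) (xi2 n a c L f y1 y2)) *
   xi2 n a c L f y1 y2)%C.

Definition pLaplacian (n : nat) (a c p L : R) (f : R -> R -> C)
    (y1 y2 : R) : C :=
  (Y1 (flux1 n a c p L f) y1 y2 + Y2 n a c (flux2 n a c p L f) y1 y2)%C.

(* Main.v *)
Require Import Defs.
From Stdlib Require Import Reals Lra Lia.
From Coquelicot Require Import Coquelicot.
Open Scope R_scope.

(** Write g = U + iV, N = n + 1, s = y1 - a, sigma = c s^n and rho = |g|^2.
    The Grushin fields act on g by Y1 g = N sigma and Y2 g = i N sigma, so a
    branch of log g satisfies Y1 (log g) = N sigma / g and
    Y2 (log g) = i N sigma / g, and log h obeys the conjugate rules.  With
    kappa = (n + 2 - p) / ((1 - p) (2n + 2)) the exponents are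
    alpha = kappa (1 + L) and beta = kappa (1 - L), hence
    f = |g|^(2 kappa) e^(2 i kappa L arg g) for p <> n + 2.

    The operators Y1 + iL Y2 and Y2 - iL Y1 cancel the angular part of the
    gradient: in both cases of the definition of f,
      xi = (1 - L^2) K N sigma rho^(-1) E (U, V),
    where E = |g|^(2 kappa) e^(2 i kappa L arg g) and K is 2 kappa, or 2 in the
    logarithmic case, where kappa = 0 and E = 1.  Thus xi is a scalar multiple of
    the real vector (U, V), and ||xi||^(p-2) xi = Phi |g|^A e^(iB arg g) (U, V)
    with B = 2 kappa L, A = (p - 2) (2 kappa - 1) - 2 + 2 kappa and
    Phi = |k s^n|^(p-2) k s^n for a constant k: this is [flux_formula].

    The divergence of this field is elementary.  Since Phi is homogeneous of
    degree (p - 1) n in s, the product Phi U has derivative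
    (p n + 1) Phi sigma in y1, while Y2 V = N sigma; the derivatives of
    |g|^A contribute N A Phi sigma, and those of e^(iB arg g) cancel.  Altogether
    the divergence is (p n + 1 + N + N A) Phi sigma |g|^A e^(iB arg g), and the
    bracket vanishes ([flux_rate_balance]).

    The only delicate points are those of the line y1 = a.  There Phi need not be
    differentiable, but it is continuous and occurs in the y1-derivative only
    through s Phi, which is differentiable with the same formula
    ([is_derive_id_signed_power]); so one computation covers all points. *)

(** * Complex-valued functions of one real variable *)

Definition curve_derive (F : R -> C) (t : R) (z : C) : Prop :=
  is_derive (fun s => Re (F s)) t (Re z) /\
  is_derive (fun s => Im (F s)) t (Im z).

Lemma curve_derive_ext_loc (F G : R -> C) (t : R) (z : C) :
  locally t (fun s => F s = G s) -> curve_derive F t z -> curve_derive G t z.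
Proof.
  intros HFG [HRe HIm]; split.
  - eapply is_derive_ext_loc; [|exact HRe].
    eapply filter_imp; [|exact HFG]; intros s Hs; now rewrite Hs.
  - eapply is_derive_ext_loc; [|exact HIm].
    eapply filter_imp; [|exact HFG]; intros s Hs; now rewrite Hs.
Qed.

Lemma curve_derive_D1 (F : R -> R -> C) (u v : R) (z : C) :
  curve_derive (fun s => F s v) u z -> ex_D1 F u v /\ D1 F u v = z.
Proof.
  intros [HRe HIm]; split.
  - split; eexists; eassumption.
  - destruct z; unfold D1; f_equal; now apply is_derive_unique.
Qed.

Lemma curve_derive_D2 (F : R -> R -> C) (u v : R) (z : C) :
  curve_derive (fun s => F u s) v z -> ex_D2 F u v /\ D2 F u v = z.
Proof.
  intros [HRe HIm]; split.
  - split; eexists; eassumption.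
  - destruct z; unfold D2; f_equal; now apply is_derive_unique.
Qed.

Lemma is_derive_transport (f g : R -> R) (t l l' : R) :
  (forall s, f s = g s) -> l = l' -> is_derive f t l -> is_derive g t l'.
Proof. intros Hfg <-; now apply is_derive_ext. Qed.

(** The eta-expanded form in which [auto_derive] leaves derivatives. *)
Lemma Derive_eta (f : R -> R) (t l : R) :
  is_derive f t l -> Derive (fun s => f s) t = l.
Proof. exact (is_derive_unique f t l). Qed.

(** * The complex exponential and its logarithms *)

Lemma Cexp_norm_square (z : C) :
  Re (Cexp z) ^ 2 + Im (Cexp z) ^ 2 = exp (2 * Re z).
Proof.
  unfold Cexp; cbn [Re Im fst snd].
  pose proof (sin2_cos2 (Im z)) as Htrig; unfold Rsqr in Htrig.
  replace (2 * Re z) with (Re z + Re z) by ring; rewrite exp_plus.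
  transitivity (exp (Re z) * exp (Re z) *
    (sin (Im z) * sin (Im z) + cos (Im z) * cos (Im z))); [|rewrite Htrig]; ring.
Qed.

Lemma is_derive_mul_exp_cos (m r th : R -> R) (A B t dm dr dth : R) :
  is_derive m t dm -> is_derive r t dr -> is_derive th t dth ->
  is_derive (fun s => m s * (exp (A * r s) * cos (B * th s))) t
    ((dm + m t * (A * dr)) * (exp (A * r t) * cos (B * th t)) -
     m t * (B * dth) * (exp (A * r t) * sin (B * th t))).
Proof.
  intros Hm Hr Hth; auto_derive; [repeat split; eexists; eassumption|].
  rewrite (Derive_eta m t dm Hm), (Derive_eta r t dr Hr),
    (Derive_eta th t dth Hth); ring.
Qed.

Lemma is_derive_mul_exp_sin (m r th : R -> R) (A B t dm dr dth : R) :
  is_derive m t dm -> is_derive r t dr -> is_derive th t dth ->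
  is_derive (fun s => m s * (exp (A * r s) * sin (B * th s))) t
    ((dm + m t * (A * dr)) * (exp (A * r t) * sin (B * th t)) +
     m t * (B * dth) * (exp (A * r t) * cos (B * th t))).
Proof.
  intros Hm Hr Hth; auto_derive; [repeat split; eexists; eassumption|].
  rewrite (Derive_eta m t dm Hm), (Derive_eta r t dr Hr),
    (Derive_eta th t dth Hth); ring.
Qed.

(** For [w = log g] this is [|g|^A e^(iB arg g)], the common shape of [f] and of
    the scalar part of its flux.  It is not a function of [g] alone: another
    branch of [log g] changes it by a constant factor. *)
Definition spiral (A B : R) (w : C) : C := Cexp (A * Re w, B * Im w).

Lemma spiral_1_1 (w : C) : spiral 1 1 w = Cexp w.
Proof. unfold spiral; now rewrite !Rmult_1_l; destruct w. Qed.

Lemma curve_derive_spiral (A B : R) (lam : R -> C) (m : R -> R) (t dm : R)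
    (dlam : C) :
  curve_derive lam t dlam -> is_derive m t dm ->
  curve_derive (fun s => RtoC (m s) * spiral A B (lam s))%C t
    ((RtoC dm + RtoC (m t) * ((A * Re dlam)%R, (B * Im dlam)%R)) *
     spiral A B (lam t))%C.
Proof.
  intros [Hr Hth] Hm.
  pose proof (is_derive_mul_exp_cos m _ _ A B t dm _ _ Hm Hr Hth) as Hcos.
  pose proof (is_derive_mul_exp_sin m _ _ A B t dm _ _ Hm Hr Hth) as Hsin.
  split; unfold spiral, Cexp, Cmult, Cplus, RtoC; cbn [Re Im fst snd].
  - refine (is_derive_transport _ _ _ _ _ _ _ Hcos); [intros s|];
      unfold Re, Im; cbn [fst snd]; ring.
  - refine (is_derive_transport _ _ _ _ _ _ _ Hsin); [intros s|];
      unfold Re, Im; cbn [fst snd]; ring.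
Qed.

Lemma curve_derive_unique (F : R -> C) (t : R) (z z' : C) :
  curve_derive F t z -> curve_derive F t z' -> z = z'.
Proof.
  intros [HRe HIm] [HRe' HIm']; apply injective_projections.
  - exact (eq_trans (eq_sym (is_derive_unique _ _ _ HRe))
      (is_derive_unique _ _ _ HRe')).
  - exact (eq_trans (eq_sym (is_derive_unique _ _ _ HIm))
      (is_derive_unique _ _ _ HIm')).
Qed.

Lemma Cexp_plus (z w : C) : Cexp (z + w)%C = (Cexp z * Cexp w)%C.
Proof.
  unfold Cexp, Cplus, Cmult, Re, Im; cbn [fst snd].
  rewrite exp_plus, cos_plus, sin_plus; f_equal; ring.
Qed.

Lemma Cexp_neq_0 (w : C) : Cexp w <> RtoC 0.
Proof.
  intros H; pose proof (Cexp_norm_square w) as Hn; rewrite H in Hn.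
  cbn [Re Im fst snd RtoC] in Hn.
  pose proof (exp_pos (2 * Re w)); nra.
Qed.

(** A differentiable family of logarithms has no freedom in its derivative: the chain
    rule for [Cexp (lam s) = G s] can be solved for the derivative of [lam], as
    [Cexp] has no zero. *)
Lemma curve_derive_log (lam G : R -> C) (t : R) (dG : C) :
  locally t (fun s => Cexp (lam s) = G s) ->
  ex_derive (fun s => Re (lam s)) t -> ex_derive (fun s => Im (lam s)) t ->
  curve_derive G t dG -> curve_derive lam t (dG / G t)%C.
Proof.
  intros Hexp [dr Hr] [dth Hth] HG.
  assert (Hlam : curve_derive lam t (dr, dth)) by now split.
  pose proof (curve_derive_spiral 1 1 lam (fun _ => 1) t 0 _ Hlam
    (is_derive_const 1 t)) as Hchain.
  apply curve_derive_ext_loc with (G := G) in Hchain.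
  2: { eapply filter_imp; [|exact Hexp]; intros s Hs.
       rewrite spiral_1_1, Hs; ring. }
  rewrite (curve_derive_unique _ _ _ _ HG Hchain).
  pose proof (Cexp_neq_0 (lam t)) as Hnz.
  rewrite spiral_1_1 in *; rewrite (locally_singleton _ _ Hexp) in *.
  cbn [Re Im fst snd]; rewrite !Rmult_1_l.
  change (@pair R R dr dth) with ((dr, dth) : C) in *.
  set (w := ((dr, dth) : C)) in *.
  replace ((RtoC 0 + RtoC 1 * w) * G t / G t)%C with w by (field; assumption).
  assumption.
Qed.

(** * The function f in logarithmic coordinates *)

(** The common factor of the exponents [alpha] and [beta]. *)
Definition kappa (n : nat) (p : R) : R :=
  (INR n + 2 - p) / ((1 - p) * (2 * INR n + 2)).

(** In the logarithmic case [kappa] vanishes and cannot carry the size of the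
    gradient; there [f = 2 log |g| + 2 i L arg g], whence the value 2. *)
Definition slope (n : nat) (p : R) : R :=
  if Req_EM_T p (INR n + 2) then 2 else 2 * kappa n p.

(** Both definitions of [f] obey one derivative rule, because the [spiral] is
    constantly 1 when [kappa = 0]. *)
Lemma curve_derive_f (n : nat) (p L : R) (lam : R -> C) (t : R) (dlam : C) :
  curve_derive lam t dlam ->
  curve_derive (fun s => f_fun n p L (fun u _ => lam u) s 0) t
    (RtoC (slope n p) * (Re dlam, (L * Im dlam)%R) *
     spiral (2 * kappa n p) (2 * kappa n p * L) (lam t))%C.
Proof.
  intros Hlam; unfold f_fun, slope.
  destruct (Req_EM_T p (INR n + 2)) as [Hp|Hp].
  - assert (Hk : kappa n p = 0)
      by (unfold kappa; rewrite Hp; unfold Rdiv; ring).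
    destruct Hlam as [Hr Hth]; rewrite Hk.
    split; unfold spiral, Cexp, Cmult, Cplus, Cconj, RtoC; cbn [Re Im fst snd];
      replace (2 * 0 * L * Im (lam t)) with 0 by ring;
      replace (2 * 0 * Re (lam t)) with 0 by ring;
      rewrite exp_0, cos_0, sin_0.
    + refine (is_derive_transport _ _ _ _ _ _ _ (is_derive_scal _ _ 2 _ Hr));
        [intros s|]; unfold Re, Im; cbn [fst snd]; ring.
    + refine (is_derive_transport _ _ _ _ _ _ _
        (is_derive_scal _ _ (2 * L) _ Hth));
        [intros s|]; unfold Re, Im; cbn [fst snd]; ring.
  - set (k := kappa n p).
    apply curve_derive_ext_loc with
      (F := fun s => (RtoC 1 * spiral (2 * k) (2 * k * L) (lam s))%C).
      (* [alpha] and [beta] have sum [2 kappa] and difference [2 kappa L]. *)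
    + apply filter_forall; intros s.
      unfold spiral, alpha, beta; fold (kappa n p); fold k.
      rewrite <- Cexp_plus, Cmult_1_l; f_equal.
      apply injective_projections; unfold Cplus, Cmult, Cconj, RtoC, Re, Im;
        cbn [fst snd]; ring.
    + replace (RtoC (2 * k) * (Re dlam, (L * Im dlam)%R))%C with
        (RtoC 0 + RtoC 1 * ((2 * k * Re dlam)%R, (2 * k * L * Im dlam)%R))%C
        by (unfold RtoC, Cmult, Cplus; cbn [fst snd]; f_equal; ring).
      apply (curve_derive_spiral _ _ _ (fun _ => 1)); [assumption|].
      exact (is_derive_const 1 t).
Qed.

(** * Powers preserving the sign *)

(** The map [t |-> |t|^q t]. *)
Definition signed_power (q t : R) : R :=
  if Req_EM_T t 0 then 0 else Rpower (Rabs t) q * t.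

(** The size of [|t|^q t] is [|t|^(q + 1)], a positive power. *)
Lemma signed_power_continuous_0 (q : R) :
  -1 < q -> continuous (signed_power q) 0.
Proof.
  intros Hq; apply continuity_pt_filterlim.
  intros eps Heps; exists (Rpower eps (/ (q + 1))); split; [apply exp_pos|].
  intros t [_ Ht]; unfold dist, R_met, R_dist in *; cbn in *.
  unfold signed_power; destruct (Req_EM_T 0 0) as [_|]; [|easy].
  rewrite Rminus_0_r in *.
  destruct (Req_EM_T t 0) as [_|Ht0]; [now rewrite Rabs_R0|].
  pose proof (Rabs_pos_lt t Ht0) as Hpos.
  rewrite Rabs_mult, (Rabs_pos_eq (Rpower _ _)) by (apply Rlt_le, exp_pos).
  rewrite <- (Rpower_1 (Rabs t)) at 2 by assumption.
  rewrite <- Rpower_plus.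
  replace eps with (Rpower (Rpower eps (/ (q + 1))) (q + 1)).
  - apply Rlt_Rpower_l; lra.
  - rewrite Rpower_mult, Rinv_l, Rpower_1; lra.
Qed.

Lemma is_derive_signed_power (q t : R) :
  t <> 0 -> is_derive (signed_power q) t ((q + 1) * (signed_power q t / t)).
Proof.
  intros Ht.
  assert (Hloc : locally t (fun s => s <> 0)).
  { exists (mkposreal _ (Rabs_pos_lt t Ht)); intros s Hs ->.
    unfold ball in Hs; cbn in Hs; unfold AbsRing_ball, abs, minus, plus, opp in Hs;
    cbn in Hs.
    rewrite Rplus_0_l, Rabs_Ropp in Hs; lra. }
  apply is_derive_ext_loc with (f := fun s => Rpower (Rabs s) q * s).
  - eapply filter_imp; [|exact Hloc]; intros s Hs.
    unfold signed_power; destruct (Req_EM_T s 0); easy.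
  - unfold signed_power; destruct (Req_EM_T t 0) as [|_]; [easy|].
    unfold Rpower.
    pose proof (Rabs_pos_lt t Ht) as Hpos.
    auto_derive; [easy|].
    assert (Hsign : sign t * / Rabs t = / t).
    { destruct (Rtotal_order t 0) as [H|[H|H]]; [|easy|].
      - rewrite sign_eq_m1, Rabs_left by assumption; field; lra.
      - rewrite sign_eq_1, Rabs_right by lra; field; lra. }
    transitivity (exp (q * ln (Rabs t)) *
      (q * (sign t * / Rabs t) * t + 1)); [ring|].
    rewrite Hsign; field; assumption.
Qed.

Lemma is_derive_id_mult_0 (h : R -> R) :
  continuous h 0 -> is_derive (fun s => s * h s) 0 (h 0).
Proof.
  intros Hc; apply is_derive_Reals; intros eps Heps.
  apply continuity_pt_filterlim in Hc.
  destruct (Hc eps Heps) as [d [Hd Hh]].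
  exists (mkposreal d Hd); intros s Hs Hsd; cbn in Hsd.
  replace ((0 + s) * h (0 + s)) with (s * h s) by (rewrite Rplus_0_l; ring).
  replace ((s * h s - 0 * h 0) / s - h 0) with (h s - h 0) by (field; assumption).
  apply (Hh s); split.
  - split; [exact I|intro H; now apply Hs].
  - unfold dist; cbn; unfold R_dist; now rewrite Rminus_0_r.
Qed.

(** Euler's relation for a homogeneous function of degree [(q + 1) n + 1].  The
    factor [s] gives differentiability at 0, where [signed_power q (k * s ^ n)]
    itself may fail to be differentiable. *)
Lemma is_derive_id_signed_power (n : nat) (q k s : R) :
  -1 < q ->
  is_derive (fun s => s * signed_power q (k * s ^ n)) s
    (((q + 1) * INR n + 1) * signed_power q (k * s ^ n)).
Proof.
  intros Hq.
  destruct (Req_EM_T k 0) as [->|Hk].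
  { assert (H0 : forall x, signed_power q (0 * x ^ n) = 0).
    { intros x; unfold signed_power; rewrite Rmult_0_l.
      destruct (Req_EM_T 0 0); easy. }
    rewrite H0, Rmult_0_r.
    refine (is_derive_transport _ _ _ _ _ _ (eq_refl _) (is_derive_const 0 s)).
    intros x; rewrite H0; symmetry; apply Rmult_0_r. }
  destruct (Req_EM_T s 0) as [->|Hs].
  - destruct n as [|n].
    + cbn [pow INR].
      auto_derive; [easy|ring].
    + replace (((q + 1) * INR (S n) + 1) * signed_power q (k * 0 ^ S n))
        with (signed_power q (k * 0 ^ S n)).
      * apply (is_derive_id_mult_0 (fun s => signed_power q (k * s ^ S n))).
        apply (continuous_comp (fun s => k * s ^ S n) (signed_power q)).
        -- apply (@ex_derive_continuous R_AbsRing R_NormedModule); auto_derive; easy.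
        -- rewrite pow_ne_zero, Rmult_0_r by easy.
           now apply signed_power_continuous_0.
      * rewrite pow_ne_zero, Rmult_0_r by easy.
        unfold signed_power; destruct (Req_EM_T 0 0); [ring|easy].
  - assert (Hm : k * s ^ n <> 0).
    { apply Rmult_integral_contrapositive_currified; [easy|].
      now apply pow_nonzero. }
    pose proof (is_derive_signed_power q _ Hm) as Hd.
    auto_derive; [eexists; exact Hd|].
    rewrite (Derive_eta _ _ _ Hd).
    destruct n as [|n]; [cbn [pow INR pred]; field; assumption|].
    cbn [pred pow]. field; repeat split; try assumption.
    now apply pow_nonzero.
Qed.

(** * Derivatives of g and of the branch of its logarithm *)

Lemma is_derive_shifted_monomial (n : nat) (a c u : R) :
  is_derive (fun s => c * (s - a) ^ (n + 1)) u (INR (n + 1) * (c * (u - a) ^ n)).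
Proof.
  auto_derive; [easy|].
  replace (n + 1)%nat with (S n) by lia; cbn [pred]; unfold Rminus; ring.
Qed.

(** The [y1]-profile of the first flux component, with [q = p - 2].  Only the
    product [s * signed_power q (k * s ^ n)], [s = x - a], is differentiated as a
    block; the remaining factor [c s^n] is a polynomial. *)
Lemma is_derive_signed_power_profile (n : nat) (q k a c x : R) :
  -1 < q ->
  is_derive
    (fun s => signed_power q (k * (s - a) ^ n) * (c * (s - a) ^ (n + 1))) x
    (((q + 2) * INR n + 1) *
     (signed_power q (k * (x - a) ^ n) * (c * (x - a) ^ n))).
Proof.
  intros Hq.
  pose (T := fun s => s * signed_power q (k * s ^ n)).
  assert (HT : is_derive T (x - a)
    (((q + 1) * INR n + 1) * signed_power q (k * (x - a) ^ n)))
    by (now apply is_derive_id_signed_power).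
  apply is_derive_ext with (f := fun s => c * (s - a) ^ n * T (s - a)).
  { intros s; unfold T; rewrite pow_add, pow_1; apply Rminus_diag_uniq; ring. }
  auto_derive; [repeat split; eexists; exact HT|].
  change (x + - a) with (x - a); rewrite (Derive_eta _ _ _ HT); unfold T.
  destruct n as [|n]; [cbn [pred pow INR]; ring|].
  rewrite S_INR; cbn [pred pow]; ring.
Qed.

Lemma g_fun_components (n : nat) (a b c u v : R) :
  Re (g_fun n a b c u v) = c * (u - a) ^ (n + 1) /\
  Im (g_fun n a b c u v) = INR (n + 1) * (v - b).
Proof.
  unfold g_fun, Cplus, Cmult, Ci, RtoC, Re, Im; cbn [fst snd]; split; ring.
Qed.

Lemma curve_derive_g_1 (n : nat) (a b c u v : R) :
  curve_derive (fun s => g_fun n a b c s v) u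
    (RtoC (INR (n + 1) * (c * (u - a) ^ n))).
Proof.
  split; cbn [RtoC Re Im fst snd].
  - apply is_derive_ext with (f := fun s => c * (s - a) ^ (n + 1));
      [intros s; symmetry; apply g_fun_components|].
    apply is_derive_shifted_monomial.
  - apply is_derive_ext with (f := fun _ => INR (n + 1) * (v - b));
      [intros s; symmetry; apply g_fun_components|].
    exact (is_derive_const _ u).
Qed.

Lemma curve_derive_g_2 (n : nat) (a b c u v : R) :
  curve_derive (fun s => g_fun n a b c u s) v (0, INR (n + 1)).
Proof.
  split; cbn [Re Im fst snd].
  - apply is_derive_ext with (f := fun _ => c * (u - a) ^ (n + 1));
      [intros s; symmetry; apply g_fun_components|].
    exact (is_derive_const _ v).
  - assert (Hlin : is_derive (fun s => INR (n + 1) * (s - b)) v (INR (n + 1)))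
      by (auto_derive; [easy|ring]).
    refine (is_derive_ext _ _ _ _ _ Hlin).
    intros s; symmetry; apply g_fun_components.
Qed.

(** All that is used of the branch: its value and its first derivatives
    [N sigma / g] and [i N / g]. *)
Definition log_derivatives_at (n : nat) (a b c : R) (lg : R -> R -> C)
    (u v : R) : Prop :=
  let g := g_fun n a b c u v in
  Cexp (lg u v) = g /\
  curve_derive (fun s => lg s v) u
    (RtoC (INR (n + 1) * (c * (u - a) ^ n)) / g)%C /\
  curve_derive (fun s => lg u s) v ((0, INR (n + 1)) / g)%C.

(** Differentiating [Cexp lg = g] at a point needs that identity near the point,
    hence the smaller radius [d / 2]. *)
Lemma smooth_log_branch_derivatives (n : nat) (a b c : R) (lg : R -> R -> C)
    (x y : R) :
  smooth_log_branch_near (g_fun n a b c) lg x y ->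
  locally_2d (log_derivatives_at n a b c lg) x y.
Proof.
  intros [d Hd]; exists (mkposreal _ (is_pos_div_2 d)); cbn [pos].
  intros u v Hu Hv.
  assert (Hnear : forall s t, Rabs (s - u) < d / 2 -> Rabs (t - v) < d / 2 ->
    Cexp (lg s t) = g_fun n a b c s t).
  { intros s t Hs Ht; apply Hd.
    - replace (s - x) with ((s - u) + (u - x)) by ring.
      pose proof (Rabs_triang (s - u) (u - x)); lra.
    - replace (t - y) with ((t - v) + (v - y)) by ring.
      pose proof (Rabs_triang (t - v) (v - y)); lra. }
  pose proof (is_pos_div_2 d) as Hd2.
  assert (Hzero : forall z, Rabs (z - z) < d / 2)
    by (intros z; rewrite Rminus_diag, Rabs_R0; lra).
  destruct (Hd u v ltac:(lra) ltac:(lra)) as [_ Hk].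
  destruct (Hk 1%nat) as [[_ [Hr1 [Hr2 _]]] [_ [Hth1 [Hth2 _]]]].
  split; [|split].
  - now apply Hnear.
  - apply (curve_derive_log (fun s => lg s v) (fun s => g_fun n a b c s v));
      try assumption; [|apply curve_derive_g_1].
    exists (mkposreal _ Hd2); intros s Hs; now apply Hnear.
  - apply (curve_derive_log (fun s => lg u s) (fun s => g_fun n a b c u s));
      try assumption; [|apply curve_derive_g_2].
    exists (mkposreal _ Hd2); intros s Hs; now apply Hnear.
Qed.

(** The first components [Re g] and [Im g] come from the radial derivative of
    [log g], the second ones from the angular derivative.  In this factored form
    [D1 f + i L Y2 f] and [Y2 f - i L D1 f] lose their angular parts by pure ring
    computation. *)
Lemma f_fun_derivatives (n : nat) (a b c p L : R) (lg : R -> R -> C) (u v : R) :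
  log_derivatives_at n a b c lg u v ->
  let f := f_fun n p L lg in
  let g := g_fun n a b c u v in
  let N := INR (n + 1) in
  let rho := Re g ^ 2 + Im g ^ 2 in
  let E := spiral (2 * kappa n p) (2 * kappa n p * L) (lg u v) in
  (ex_D1 f u v /\ D1 f u v =
    (RtoC (slope n p * N * c * (u - a) ^ n / rho) * (Re g, (- L * Im g)%R) * E)%C)
  /\
  (ex_D2 f u v /\ D2 f u v =
    (RtoC (slope n p * N / rho) * (Im g, (L * Re g)%R) * E)%C).
Proof.
  intros [Hexp [H1 H2]] f g N rho E.
  assert (Hrho : 0 < rho).
  { unfold rho, g; rewrite <- Hexp, Cexp_norm_square; apply exp_pos. }
  pose proof (curve_derive_f n p L (fun s => lg s v) u _ H1) as F1.
  pose proof (curve_derive_f n p L (fun s => lg u s) v _ H2) as F2.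
  apply (curve_derive_D1 f) in F1; apply (curve_derive_D2 f) in F2.
  fold N g E in F1, F2.
  destruct F1 as [F1 ->], F2 as [F2 ->].
  unfold rho in *; clearbody E g; destruct g as [U V]; cbn [Re Im fst snd] in *.
  split; (split; [assumption|]).
  - f_equal; apply injective_projections;
      unfold Cdiv, Cmult, Cinv, RtoC, Re, Im; cbn [fst snd]; field; nra.
  - f_equal; apply injective_projections;
      unfold Cdiv, Cmult, Cinv, RtoC, Re, Im; cbn [fst snd]; field; nra.
Qed.

(** * The flux *)

(** A vector [z = m |g|^(-2) E (Re g, Im g)], with [w = log g] and
    [|E| = |g|^A], has norm [|m| |g|^(A - 1)]; so [||z||^(p - 2)] turns [m] into a
    signed power and only changes the exponent of [|g|].  At [m = 0] both the
    weight and the signed power are 0. *)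
Lemma flux_factor (p A B m : R) (w : C) :
  let E := spiral A B w in
  let z1 := (RtoC (m * exp (-2 * Re w) * Re (Cexp w)) * E)%C in
  let z2 := (RtoC (m * exp (-2 * Re w) * Im (Cexp w)) * E)%C in
  weight p z1 z2 * m * exp (-2 * Re w) =
  signed_power (p - 2) m * exp (((p - 2) * (A - 1) - 2) * Re w).
Proof.
  intros E z1 z2.
  assert (Hnorm : norm2 z1 z2 = Rabs m * exp ((A - 1) * Re w)).
  { unfold norm2.
    replace (Re (z1 * Cconj z1 + z2 * Cconj z2)%C)
      with (Rsqr (m * exp ((A - 1) * Re w))).
    - rewrite sqrt_Rsqr_abs, Rabs_mult; f_equal.
      apply Rabs_pos_eq, Rlt_le, exp_pos.
    - transitivity ((m * exp (-2 * Re w)) ^ 2 *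
        (Re (Cexp w) ^ 2 + Im (Cexp w) ^ 2) * (Re E ^ 2 + Im E ^ 2)).
      + unfold E, spiral; rewrite !Cexp_norm_square; cbn [Re fst].
        unfold Rsqr.
        replace ((m * exp (-2 * Re w)) ^ 2) with
          (m * m * (exp (-2 * Re w) * exp (-2 * Re w))) by ring.
        replace (m * exp ((A - 1) * Re w) * (m * exp ((A - 1) * Re w))) with
          (m * m * (exp ((A - 1) * Re w) * exp ((A - 1) * Re w))) by ring.
        rewrite !Rmult_assoc, <- !exp_plus; do 3 f_equal; ring.
      + unfold z1, z2, Cconj, Cmult, Cplus, RtoC; cbn [Re Im fst snd].
        unfold Re, Im; ring. }
  unfold weight; rewrite Hnorm; unfold signed_power.
  pose proof (exp_pos ((A - 1) * Re w)) as Hexp.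
  destruct (Req_EM_T m 0) as [->|Hm].
  - ring.
  - destruct (Req_EM_T (Rabs m * exp ((A - 1) * Re w)) 0) as [H0|_].
    + pose proof (Rabs_pos_lt m Hm); nra.
    + rewrite <- Rpower_mult_distr by (try apply Rabs_pos_lt; assumption).
      replace (Rpower (exp ((A - 1) * Re w)) (p - 2)) with
        (exp ((p - 2) * ((A - 1) * Re w)))
        by (unfold Rpower; now rewrite ln_exp).
      replace (((p - 2) * (A - 1) - 2) * Re w) with
        ((p - 2) * ((A - 1) * Re w) + -2 * Re w) by ring.
      rewrite exp_plus; ring.
Qed.

(** Up to [rho = |g|^2] and the [spiral], [xi] is [strength * s^n * (Re g, Im g)]
    with [s = y1 - a]. *)
Definition strength (n : nat) (c p L : R) : R :=
  slope n p * (1 - L ^ 2) * INR (n + 1) * c.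

(** The exponent of [|g|] in the flux: [(p - 2) (2 kappa - 1)] from the weight,
    [-2] from [1 / rho] and [2 kappa] from the [spiral] in [xi]. *)
Definition flux_rate (n : nat) (p : R) : R :=
  (p - 2) * (2 * kappa n p - 1) - 2 + 2 * kappa n p.

(** The formula also holds where [xi] vanishes, on the line [y1 = a] or for
    [L^2 = 1], so it can be differentiated at every point. *)
Lemma flux_formula (n : nat) (a b c p L : R) (lg : R -> R -> C) (u v : R) :
  log_derivatives_at n a b c lg u v ->
  let f := f_fun n p L lg in
  let g := g_fun n a b c u v in
  let Phi := signed_power (p - 2) (strength n c p L * (u - a) ^ n) in
  let S := spiral (flux_rate n p) (2 * kappa n p * L) (lg u v) in
  flux1 n a c p L f u v = (RtoC (Phi * Re g) * S)%C /\
  flux2 n a c p L f u v = (RtoC (Phi * Im g) * S)%C.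
Proof.
  intros Hlog f g Phi S.
  destruct (f_fun_derivatives n a b c p L lg u v Hlog)
    as [[_ HD1] [_ HD2]].
  destruct Hlog as [Hexp _].
  set (A := 2 * kappa n p) in *.
  set (E := spiral A (A * L) (lg u v)) in *.
  set (m := strength n c p L * (u - a) ^ n) in *.
  fold f g in HD1, HD2, Hexp.
  assert (Hrho : Re g ^ 2 + Im g ^ 2 = exp (2 * Re (lg u v)))
    by (rewrite <- Hexp; apply Cexp_norm_square).
  rewrite Hrho in HD1, HD2.
  set (r := Re (lg u v)) in *.
  assert (Hinv : forall z, z / exp (2 * r) = z * exp (-2 * r)).
  { intros z; unfold Rdiv; rewrite <- exp_Ropp; do 2 f_equal; ring. }
  assert (Hxi1 : xi1 n a c L f u v = (RtoC (m * exp (-2 * r) * Re g) * E)%C).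
  { unfold xi1, Y1, Y2; rewrite HD1, HD2, !Hinv.
    unfold m, strength; clearbody E g; apply injective_projections;
      unfold Cplus, Cmult, Ci, RtoC, Re, Im; cbn [fst snd]; ring. }
  assert (Hxi2 : xi2 n a c L f u v = (RtoC (m * exp (-2 * r) * Im g) * E)%C).
  { unfold xi2, Y1, Y2; rewrite HD1, HD2, !Hinv.
    unfold m, strength; clearbody E g; apply injective_projections;
      unfold Cminus, Cplus, Copp, Cmult, Ci, RtoC, Re, Im; cbn [fst snd]; ring. }
  pose proof (flux_factor p A (A * L) m (lg u v)) as Hfactor.
  cbv zeta in Hfactor; fold E r in Hfactor.
  rewrite Hexp, <- Hxi1, <- Hxi2 in Hfactor; fold Phi in Hfactor.
  assert (HS : S = (RtoC (exp (((p - 2) * (A - 1) - 2) * r)) * E)%C).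
  { unfold S, E, spiral, Cexp, flux_rate; cbn [Re Im fst snd]; fold r A.
    replace (((p - 2) * (A - 1) - 2 + A) * r) with
      (((p - 2) * (A - 1) - 2) * r + A * r) by ring.
    rewrite exp_plus; unfold Cmult, RtoC; cbn [fst snd].
    f_equal; ring. }
  unfold flux1, flux2; rewrite HS.
  set (w := weight _ _ _) in *.
  split; [rewrite Hxi1|rewrite Hxi2].
  - transitivity (RtoC (w * m * exp (-2 * r) * Re g) * E)%C;
      [|rewrite Hfactor]; rewrite ?RtoC_mult; ring.
  - transitivity (RtoC (w * m * exp (-2 * r) * Im g) * E)%C;
      [|rewrite Hfactor]; rewrite ?RtoC_mult; ring.
Qed.

(** The reason for the value of [kappa]: the left side is affine in [kappa] with
    slope [2 N (p - 1)], so it vanishes for this exponent only. *)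
Lemma flux_rate_balance (n : nat) (p : R) :
  1 < p ->
  p * INR n + 1 + INR (n + 1) + INR (n + 1) * flux_rate n p = 0.
Proof.
  intros Hp; unfold flux_rate, kappa; rewrite plus_INR; cbn [INR].
  pose proof (pos_INR n); field; lra.
Qed.

(** * The p-Laplace equation *)

Theorem theorem5p1 :
  forall (n : nat) (a b c p L : R),
    (1 <= n)%nat -> c <> 0 -> 1 < p ->
    forall x y : R, (x, y) <> (a, b) ->
    forall lg : R -> R -> C,
      smooth_log_branch_near (g_fun n a b c) lg x y ->
      let f := f_fun n p L lg in
      locally_2d (fun u v => ex_D1 f u v /\ ex_D2 f u v) x y /\
      ex_D1 (flux1 n a c p L f) x y /\
      ex_D2 (flux2 n a c p L f) x y /\
      pLaplacian n a c p L f x y = RtoC 0.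
Proof.
  intros n a b c p L _ _ Hp x y _ lg Hbranch f.
  apply smooth_log_branch_derivatives in Hbranch.
  split.
  { eapply locally_2d_impl; [|exact Hbranch].
    apply locally_2d_forall; intros u v Huv.
    now destruct (f_fun_derivatives n a b c p L lg u v Huv) as [[] []]. }
  destruct (locally_2d_singleton _ _ _ Hbranch) as [Hexp [Hlog1 Hlog2]].
  set (q := p - 2).
  set (k := strength n c p L).
  set (A := flux_rate n p).
  set (B := 2 * kappa n p * L).
  set (Phi := signed_power q (k * (x - a) ^ n)).
  assert (Hm1 : is_derive
    (fun s => signed_power q (k * (s - a) ^ n) * Re (g_fun n a b c s y)) x
    ((p * INR n + 1) * (Phi * (c * (x - a) ^ n)))).
  { apply is_derive_ext with (f := fun s =>
      signed_power q (k * (s - a) ^ n) * (c * (s - a) ^ (n + 1))).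
    { intros s; now rewrite (proj1 (g_fun_components n a b c s y)). }
    replace (p * INR n + 1) with ((q + 2) * INR n + 1) by (unfold q; ring).
    apply is_derive_signed_power_profile; unfold q; lra. }
  assert (Hm2 : is_derive
    (fun s => Phi * Im (g_fun n a b c x s)) y (Phi * INR (n + 1))).
  { apply is_derive_scal, (proj2 (curve_derive_g_2 n a b c x y)). }
  assert (HF1 := curve_derive_spiral A B _ _ _ _ _ Hlog1 Hm1).
  assert (HF2 := curve_derive_spiral A B _ _ _ _ _ Hlog2 Hm2).
  apply curve_derive_ext_loc with (G := fun s => flux1 n a c p L f s y) in HF1.
  2: { eapply filter_imp; [|exact (locally_2d_1d_const_y _ _ _ Hbranch)].
       intros s Hs; symmetry; now apply flux_formula with (b := b). }
  apply curve_derive_ext_loc with (G := fun s => flux2 n a c p L f x s) in HF2.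
  2: { eapply filter_imp; [|exact (locally_2d_1d_const_x _ _ _ Hbranch)].
       intros s Hs; symmetry; now apply flux_formula with (b := b). }
  apply curve_derive_D1 in HF1; apply curve_derive_D2 in HF2.
  destruct HF1 as [Hex1 HD1], HF2 as [Hex2 HD2].
  split; [assumption|]; split; [assumption|].
  unfold pLaplacian, Y1, Y2; rewrite HD1, HD2.
  pose proof (flux_rate_balance n p Hp) as Hbalance; fold A in Hbalance.
  pose proof (Cexp_norm_square (lg x y)) as Hnorm; rewrite Hexp in Hnorm.
  pose proof (exp_pos (2 * Re (lg x y))) as Hpos; rewrite <- Hnorm in Hpos.
  set (S := spiral A B (lg x y)).
  set (N := INR (n + 1)) in *.
  clear - Hbalance Hpos.
  fold Phi.
  clearbody Phi N A B S.
  destruct (g_fun n a b c x y) as [U V]; cbn [Re Im fst snd] in *.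
  (* The terms with [B] cancel, and those with [A] add up to [N * A] because
     [U ^ 2 + V ^ 2] is the denominator of [1 / g]. *)
  transitivity (RtoC ((p * INR n + 1 + N + N * A) * (Phi * (c * (x - a) ^ n))) * S)%C.
  2: { rewrite Hbalance, Rmult_0_l; ring. }
  rewrite Cmult_assoc, <- Cmult_plus_distr_r; f_equal.
  apply injective_projections;
    unfold Cdiv, Cplus, Cmult, Cinv, RtoC, Re, Im; cbn [fst snd]; field; nra.
Qed.
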